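(* Let $N\in\mathbb{N}$, $\tau\in\mathbb{N}_0$, and for $i,j,l\in\{1,\ldots,N\}$ let $c_i:\mathbb{N}_0\to(-1,1)$, $\tau_{ijl},\xi_{ijl}:\mathbb{N}_0\to\mathbb{N}_0$, $a_{ij},b_{ijl}:\mathbb{N}_0\to\mathbb{R}$ and $f_j,g_j:\mathbb{R}\to\mathbb{R}$ be functions. Assume: (i) the functions $a_{ij},b_{ijl},\tau_{ijl},\xi_{ijl}$ are bounded; put $c_i^+=\sup_m|c_i(m)|$, $a_{ij}^+=\sup_m|a_{ij}(m)|$, $b_{ijl}^+=\sup_m|b_{ijl}(m)|$; (ii) for each $j$ there are constants $F_j$ and $G_j$ such that $|f_j(x)-f_j(y)|\le F_j|x-y|$ and $|g_j(x)-g_j(y)|\le G_j|x-y|$ for all $x,y\in\mathbb{R}$; (iii) for each $j$ there is $m_j>0$ such that $|g_j(u)|\le m_j$ for all $u\in\mathbb{R}$. If there is $\overline d=(d_1,\ldots,d_N)$ with $d_i>0$ for all $i$ such that $$d_i(1-c_i^+)>\sum_{j=1}^N\left(d_jF_ja_{ij}^++\sum_{l=1}^N b_{ijl}^+\big(m_jd_lG_l+m_ld_jG_j\big)\right)\qquad\text{for all }i\in\{1,\ldots,N\},$$ then the model $$x_i(m+1)=c_i(m)x_i(m-\tau)+\sum_{j=1}^N a_{ij}(m)f_j(x_j(m))+\sum_{j=1}^N\sum_{l=1}^N b_{ijl}(m)\,g_j\big(x_j(m-\tau_{ijl}(m))\big)\,g_l\big(x_l(m-\xi_{ijl}(m))\big),$$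 $m\in\mathbb{N}_0$, $i\in\{1,\ldots,N\}$, is globally exponentially stable.
   Context: $\mathbb{N}=\{1,2,\ldots\}$, $\mathbb{N}_0=\mathbb{N}\cup\{0\}$. Put $r=-\max_{i,j,l,m}\{\tau_{ijl}(m),\xi_{ijl}(m),\tau\}$ (maximum over all indices and all times $m\in\mathbb{N}_0$). For $I\subseteq\mathbb{R}$, $I_{\mathbb{Z}}=I\cap\mathbb{Z}$. $X$ is the space of functions $\alpha:[r,0]_{\mathbb{Z}}\to\mathbb{R}$ with norm $\|\alpha\|=\max_{j=r,\ldots,0}|\alpha(j)|$. $X^N$ carries the norm $\|\overline\alpha\|=\max_{i=1,\ldots,N}\|\alpha_i\|$. For $\overline{x}=(x_1,\ldots,x_N):[r,+\infty)_{\mathbb{Z}}\to\mathbb{R}^N$ and $m\in\mathbb{N}_0$, $\overline{x}_m\in X^N$ is defined by $\overline{x}_m(j)=\overline{x}(m+j)$, $j=r,\ldots,0$. For $\overline\alpha\in X^N$, $\overline{x}(\cdot,\overline\alpha)$ is the unique solution with $\overline{x}_0=\overline\alpha$, and $\overline{x}_m(\cdot,\overline\alpha)$ is its segment at time $m$. The model is globally exponentially stable if there are $C>0$ and $\zeta\in(0,1)$ such that $\|\overline{x}_m(\cdot,\overline\alpha)-\overline{x}_m(\cdot,\overline\beta)\|\le C\zeta^m\|\overline\alpha-\overline\beta\|$ for all $\overline\alpha,\overline\beta\in X^N$ and $m\in\mathbb{N}_0$. *)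

(* Defs.v *)
From HB Require Import structures.
From mathcomp Require Import all_boot all_order all_algebra zify.
From mathcomp Require Import all_classical all_reals all_analysis.

Set Implicit Arguments.
Unset Strict Implicit.
Unset Printing Implicit Defensive.

Import Order.TTheory GRing.Theory Num.Theory.
Import numFieldNormedType.Exports.

Local Open Scope classical_set_scope.
Local Open Scope ring_scope.

Definition sup_abs (R : realType) (u : nat -> R) : R :=
  sup (range (fun m => `|u m|)).

(* The natural number -r.  For bounded delays this is a genuine maximum
   (see [max_delayP]); [supremum] takes its default value 0 on unbounded
   sets. *)
Definition max_delay (N tau : nat) (tauf xi : 'I_N -> 'I_N -> 'I_N -> nat -> nat)
    : nat :=
  supremum 0%N [set d | d = tau \/
    exists i j l m, d = tauf i j l m \/ d = xi i j l m].

(* With k = -r, an element (alpha_1, ..., alpha_N) of X^N is the matrix whose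
   entry (i, s) is alpha_i(-s), 0 <= s <= k; the norm `|_| on matrices is the
   largest absolute value of an entry, i.e. max_i max_{r <= j <= 0}
   |alpha_i(j)|.  A trajectory is a family of functions on all of [int]; its
   values at times < r are never constrained and never read. *)
Definition segment (R : realType) (N k : nat) (x : 'I_N -> int -> R) (m : nat)
    : 'M[R]_(N, k.+1) :=
  \matrix_(i < N, s < k.+1) x i (m%:Z - s%:Z).

Section Model.
Variables (R : realType) (N tau : nat).
Variables (c : 'I_N -> nat -> R) (a : 'I_N -> 'I_N -> nat -> R).
Variables (b : 'I_N -> 'I_N -> 'I_N -> nat -> R).
Variables (tauf xi : 'I_N -> 'I_N -> 'I_N -> nat -> nat).
Variables (f g : 'I_N -> R -> R).

Definition model_rhs (x : 'I_N -> int -> R) (m : nat) (i : 'I_N) : R :=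
  c i m * x i (m%:Z - tau%:Z)
  + \sum_(j < N) a i j m * f j (x j m%:Z)
  + \sum_(j < N) \sum_(l < N)
      b i j l m * g j (x j (m%:Z - (tauf i j l m)%:Z))
                * g l (x l (m%:Z - (xi i j l m)%:Z)).

(* x is the solution x(., alpha); see [ex_solution] and [solution_unique]. *)
Definition is_solution (k : nat) (alpha : 'M[R]_(N, k.+1))
    (x : 'I_N -> int -> R) : Prop :=
  segment k x 0 = alpha /\
  forall (m : nat) (i : 'I_N), x i m.+1%:Z = model_rhs x m i.

Definition globally_exponentially_stable : Prop :=
  let k := max_delay tau tauf xi in
  exists C zeta : R, [/\ 0 < C, 0 < zeta < 1 &
    forall (alpha beta : 'M[R]_(N, k.+1)) (x y : 'I_N -> int -> R),
      is_solution alpha x -> is_solution beta y ->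
      forall m : nat,
        `|segment k x m - segment k y m| <= C * zeta ^+ m * `|alpha - beta|].

Lemma max_delayP :
  (forall i j l, has_ubound (range (tauf i j l))) ->
  (forall i j l, has_ubound (range (xi i j l))) ->
  let D := [set d | d = tau \/
    exists i j l m, d = tauf i j l m \/ d = xi i j l m] in
  D (max_delay tau tauf xi) /\
  forall d, D d -> (d <= max_delay tau tauf xi)%N.
Proof.
move=> htau hxi D.
have [M hM] : exists M : nat, forall d, D d -> (d <= M)%N.
  have ubd (u : 'I_N -> 'I_N -> 'I_N -> nat -> nat) :
      (forall i j l, has_ubound (range (u i j l))) ->
      exists M : nat, forall i j l m, (u i j l m <= M)%N.
    move=> hu; have /choice[B hB] (p : 'I_N * 'I_N * 'I_N) :
        exists B : nat, forall m, (u p.1.1 p.1.2 p.2 m <= B)%N.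
      by have [B hB] := hu p.1.1 p.1.2 p.2; exists B => m; apply: hB; exists m.
    exists (\max_p B p)%N => i j l m.
    exact: leq_trans (hB (i, j, l) m) (leq_bigmax _).
  have [M1 h1] := ubd _ htau; have [M2 h2] := ubd _ hxi.
  exists (maxn tau (maxn M1 M2)) => d [->|[i [j [l [m [->|->]]]]]].
  - by rewrite leq_maxl.
  - by have := h1 i j l m; lia.
  - by have := h2 i j l m; lia.
have exD : exists d, `[< D d >] by exists tau; apply/asboolP; left.
have bndD d : `[< D d >] -> (d <= M)%N by move=> /asboolP /hM.
have [s /asboolP Ds maxs] := ex_maxnP exD bndD.
suff -> : max_delay tau tauf xi = s.
  by split=> // d Dd; apply: maxs; apply/asboolP.
rewrite /max_delay /supremum ifF; last first.
  by apply/negbTE/set0P; exists tau; left.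
have sups : supremums D s.
  split=> [d Dd|d ubd]; last by rewrite leEnat; exact: (ubd _ Ds).
  by rewrite leEnat; apply: maxs; apply/asboolP.
case: xgetP => [y _ [ubY lbY]|/(_ s)//].
by apply/le_anti; rewrite (lbY _ sups.1) (ubY _ Ds).
Qed.

Lemma model_rhs_ext (x y : 'I_N -> int -> R) (m : nat) (i : 'I_N) (k : nat) :
  (tau <= k)%N -> (forall j l, tauf i j l m <= k)%N ->
  (forall j l, xi i j l m <= k)%N ->
  (forall j (t : int), m%:Z - k%:Z <= t -> t <= m%:Z -> x j t = y j t) ->
  model_rhs x m i = model_rhs y m i.
Proof.
move=> htau ht hx xy; rewrite /model_rhs xy; [|lia..].
congr (_ + _ + _).
  by apply: eq_bigr => j _; rewrite xy //; lia.
apply: eq_bigr => j _; apply: eq_bigr => l _.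
by have := ht j l; have := hx j l => ? ?; rewrite !(xy j, xy l) //; lia.
Qed.

Fixpoint iter_solution (k : nat) (alpha : 'M[R]_(N, k.+1)) (n : nat)
    : 'I_N -> int -> R :=
  if n is n'.+1 then fun i t =>
    if t == n%:Z then model_rhs (iter_solution alpha n') n' i
    else iter_solution alpha n' i t
  else fun i t => alpha i (inord `|t|%N).

Lemma ex_solution (k : nat) (alpha : 'M[R]_(N, k.+1)) :
  exists x, is_solution alpha x.
Proof.
pose x i (t : int) := iter_solution alpha (if t is Posz n then n else 0%N) i t.
have stab n p i (t : int) : t <= n%:Z ->
    iter_solution alpha (n + p) i t = iter_solution alpha n i t.
  move=> tn; elim: p => [|p IH]; first by rewrite addn0.
  by rewrite addnS /= ifF //; apply/eqP; lia.
have xE n i (t : int) : t <= n%:Z -> iter_solution alpha n i t = x i t.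
  rewrite /x; case: t => [p|p] tn; last exact: (stab 0%N n).
  have -> : n = (p + (n - p))%N by lia.
  exact: stab.
exists x; split.
  apply/matrixP => i s; rewrite mxE /x sub0r.
  have -> : (if - s%:Z is Posz n then n else 0%N) = 0%N.
    by case: (nat_of_ord s).
  by rewrite /= abszN absz_nat inord_val.
move=> m i; rewrite {1}/x /= eqxx.
set K := (tau + \sum_j \sum_l (tauf i j l m + xi i j l m))%N.
have hK j l : (tauf i j l m + xi i j l m <= K)%N.
  rewrite /K (bigD1 j) //= (bigD1 l) //=; lia.
apply: (@model_rhs_ext _ _ m i K).
- by rewrite /K; lia.
- by move=> j l; have := hK j l; lia.
- by move=> j l; have := hK j l; lia.
- by move=> j t _ tm; exact: xE.
Qed.

Lemma solution_unique (k : nat) (alpha : 'M[R]_(N, k.+1)) x y :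
  (tau <= k)%N -> (forall i j l m, tauf i j l m <= k)%N ->
  (forall i j l m, xi i j l m <= k)%N ->
  is_solution alpha x -> is_solution alpha y ->
  forall i (t : int), - k%:Z <= t -> x i t = y i t.
Proof.
move=> htau ht hx [x0 xS] [y0 yS].
suff H n i (t : int) : - k%:Z <= t -> t <= n%:Z -> x i t = y i t.
  by move=> i t kt; apply: (H `|t|%N) => //; lia.
elim: n i t => [|n IH] i t kt tn.
  have sk : (`|t| < k.+1)%N by lia.
  have /matrixP/(_ i (Ordinal sk)) : segment k x 0 = segment k y 0.
    by rewrite x0 y0.
  by rewrite !mxE /=; have -> : 0%:Z - `|t|%N%:Z = t by lia.
have [->|tn'] := eqVneq t n.+1%:Z; last by apply: IH => //; lia.
rewrite xS yS; apply: (@model_rhs_ext _ _ n i k) => // j s ks sn.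
by apply: IH => //; lia.
Qed.

End Model.

(* Main.v *)
Require Import Defs.
From HB Require Import structures.
From mathcomp Require Import all_boot all_order all_algebra.
From mathcomp Require Import all_classical all_reals all_analysis.
From mathcomp Require Import zify ring.

Import Order.TTheory GRing.Theory Num.Theory.
Import numFieldNormedType.Exports.

Local Open Scope classical_set_scope.
Local Open Scope ring_scope.

(** Take two solutions [x] and [y] and measure their distance in each
    coordinate relative to the weights: [w i t = |x i t - y i t| / d i].
    Subtracting the two recurrences and using the Lipschitz bounds, the bounds
    on the [g j] and the suprema of the coefficients ([model_rhs_dist_le]),
    [d i * w i (m + 1)] is at most the largest value of [w] on the window
    [m - k, m] times
      [d_i c_i^+ + sum_j (d_j F_j a_ij^+
                          + sum_l b_ijl^+ (m_j d_l G_l + m_l d_j G_j))].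
    The hypothesis on the weights says exactly that this factor is smaller
    than [d i].  There are finitely many indices, so a single [q < 1] serves
    them all ([ex_common_ratio]): each new value of [w] is at most [q] times
    the maximum of [w] over the preceding window of length [k + 1].

    Such a delayed contraction forces exponential decay ([halanay]), with a
    rate [zeta] satisfying [zeta ^ (k + 1) = q].  The delays vary with time,
    but they enter only through [k].  Going back from [w] to the norm of [X^N]
    costs the factors [D >= d i] and [M >= 1 / d i], and absorbing the initial
    window costs [zeta ^ - k]. *)

Set Implicit Arguments.
Unset Strict Implicit.

Lemma le_sup_abs (R : realType) (u : nat -> R) (M : R) (m : nat) :
  (forall n, `|u n| <= M) -> `|u m| <= sup_abs u.
Proof.
move=> uM; apply: ub_le_sup; last by exists m.
by exists M => _ [n _ <-].
Qed.

Lemma le_sup_abs_bounded (R : realType) (u : nat -> R) (m : nat) :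
  bounded_fun u -> `|u m| <= sup_abs u.
Proof.
case=> M [_ uM]; apply: (@le_sup_abs _ _ (M + 1)) => n.
by apply: uM => //; rewrite ltrDl.
Qed.

Lemma lipschitz_const_ge0 (R : realType) (h : R -> R) (L : R) :
  (forall x y, `|h x - h y| <= L * `|x - y|) -> 0 <= L.
Proof.
move=> /(_ 1 0); rewrite subr0 normr1 mulr1; exact: le_trans.
Qed.

Lemma lipschitz_le (R : realType) (h : R -> R) (L : R) (x y u : R) :
  (forall x y, `|h x - h y| <= L * `|x - y|) ->
  `|x - y| <= u -> `|h x - h y| <= L * u.
Proof.
move=> hL xyu; apply: le_trans (hL x y) _.
by apply: ler_wpM2l => //; exact: lipschitz_const_ge0 hL.
Qed.

(** Splitting [p q - p' q'] as [p (q - q') + (p - p') q'] is what makes a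
    product of bounded Lipschitz functions Lipschitz. *)
Lemma dist_mul_le (R : realType) (p p' q q' P Q dp dq : R) :
  `|p| <= P -> `|q'| <= Q -> `|p - p'| <= dp -> `|q - q'| <= dq ->
  `|p * q - p' * q'| <= P * dq + Q * dp.
Proof.
move=> pP qQ ppd qqd.
have -> : p * q - p' * q' = p * (q - q') + q' * (p - p').
  by ring.
by rewrite (le_trans (ler_normD _ _))// !normrM lerD// ler_pM.
Qed.

(** The discrete Halanay inequality.  Since [t = m + 1] exceeds every time of
    the window [m - k, m] by at most [k + 1], a decay by the factor [q] over
    one window is a decay by [zeta] per time unit, as soon as
    [q <= zeta ^ (k + 1)]. *)
Lemma halanay (R : realType) (I : Type) (w : I -> int -> R) (k : nat)
    (q zeta E : R) :
  0 < zeta <= 1 -> q <= zeta ^+ k.+1 -> 0 <= E ->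
  (forall i (s : nat), (s <= k)%N -> w i (0%:Z - s%:Z) <= E) ->
  (forall (m : nat) V, 0 <= V ->
    (forall i (s : nat), (s <= k)%N -> w i (m%:Z - s%:Z) <= V) ->
    forall i, w i m.+1%:Z <= q * V) ->
  forall (m : nat) i (s : nat), (s <= k)%N ->
    w i (m%:Z - s%:Z) <= E / zeta ^+ k * zeta ^+ m.
Proof.
move=> /andP[z0 z1] qz E0 w0 wS.
set K := E / zeta ^+ k.
have K0 : 0 <= K by rewrite divr_ge0// exprn_ge0 ?ltW.
(* The sharp form of the bound, [w i t <= K * zeta ^ (t + k)], indexed by
   [n = t + k] so as to stay within the natural numbers. *)
have main n i : w i (n%:Z - k%:Z) <= K * zeta ^+ n.
  elim/ltn_ind: n i => n IH i.
  have [nk|kn] := leqP n k.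
    have -> : n%:Z - k%:Z = 0%:Z - (k - n)%N%:Z by lia.
    apply: le_trans (w0 _ _ _) _; first by lia.
    rewrite /K -mulrA ler_peMr// mulrC ler_pdivlMr ?exprn_gt0// mul1r.
    by apply: ler_wiXn2l => //; exact: ltW.
  have -> : n%:Z - k%:Z = (n - k.+1)%N.+1%:Z by lia.
  have V0 : 0 <= K * zeta ^+ (n - k.+1) by rewrite mulr_ge0// exprn_ge0 ?ltW.
  apply: le_trans (wS _ _ V0 _ i) _ => [j s sk|].
    have -> : (n - k.+1)%N%:Z - s%:Z = (n - k.+1 + (k - s))%N%:Z - k%:Z by lia.
    apply: le_trans (IH _ _ j) _; first by lia.
    by apply: ler_wpM2l => //; apply: ler_wiXn2l; [exact: ltW| |lia].
  apply: le_trans (ler_wpM2r V0 qz) _.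
  by rewrite mulrCA -exprD subnKC.
move=> m i s sk.
have -> : m%:Z - s%:Z = (m + (k - s))%N%:Z - k%:Z by lia.
apply: le_trans (main _ _) _.
by apply: ler_wpM2l => //; apply: ler_wiXn2l; [exact: ltW| |lia].
Qed.

Lemma ex_root_lt1 (R : realType) (q : R) (k : nat) :
  0 < q < 1 -> exists zeta : R, 0 < zeta < 1 /\ zeta ^+ k.+1 = q.
Proof.
move=> /andP[q0 q1]; exists (q `^ k.+1%:R^-1); split; last first.
  by rewrite -powR_mulrn ?powR_ge0// -powRrM mulVf ?pnatr_eq0// powRr1// ltW.
rewrite powR_gt0//= -[ltRHS](congr1 (@^~ k.+1%:R^-1) (powR1 R)).
by apply: gt0_ltr_powR => //; rewrite nnegrE ltW.
Qed.

(** The initial value [1/2] of the maximum keeps [q] positive, so that [q] has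
    a root to serve as decay rate, even when every [u i] vanishes. *)
Lemma ex_common_ratio (R : realType) (I : finType) (u d : I -> R) :
  (forall i, 0 < d i) -> (forall i, u i < d i) ->
  exists q : R, 0 < q < 1 /\ forall i, u i <= q * d i.
Proof.
move=> d0 ud; exists (\big[Num.max/2^-1]_i (u i / d i)); split.
  apply/andP; split.
    by apply: lt_le_trans (bigmax_ge_id _ _ _ _); rewrite invr_gt0 ltr0n.
  apply/bigmax_ltP; split; first by rewrite invf_lt1 ?ltr1n ?ltr0n.
  by move=> i _; rewrite ltr_pdivrMr// mul1r.
by move=> i; rewrite -ler_pdivrMr//; exact: le_bigmax.
Qed.

Section Matrix_norm.
Variables (R : realType) (n p : nat).
Implicit Type A : 'M[R]_(n, p).

Lemma mx_entry_le_norm A i j : `|A i j| <= `|A|.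
Proof.
rewrite [leRHS]/Num.Def.normr /= mx_normrE.
exact: (le_bigmax _ (fun ij : 'I_n * 'I_p => `|A ij.1 ij.2|) (i, j)).
Qed.

Lemma mx_norm_le_entries A (M : R) :
  0 <= M -> (forall i j, `|A i j| <= M) -> `|A| <= M.
Proof.
move=> M0 AM; rewrite [leLHS]/Num.Def.normr /= mx_normrE.
by apply: bigmax_le => // -[i j] _; exact: AM.
Qed.

End Matrix_norm.

Section Model_rhs_distance.
Variables (R : realType) (N tau : nat).
Variables (c : 'I_N -> nat -> R) (a : 'I_N -> 'I_N -> nat -> R).
Variables (b : 'I_N -> 'I_N -> 'I_N -> nat -> R).
Variables (tauf xi : 'I_N -> 'I_N -> 'I_N -> nat -> nat).
Variables (f g : 'I_N -> R -> R) (F G mg : 'I_N -> R).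
Hypothesis c_range : forall i m, -1 < c i m < 1.
Hypothesis a_bounded : forall i j, bounded_fun (a i j).
Hypothesis b_bounded : forall i j l, bounded_fun (b i j l).
Hypothesis f_lipschitz : forall j x y, `|f j x - f j y| <= F j * `|x - y|.
Hypothesis g_lipschitz : forall j x y, `|g j x - g j y| <= G j * `|x - y|.
Hypothesis g_bounded : forall j u, `|g j u| <= mg j.

(** All the states read at time [m] lie in the window [m - k, m], so
    coordinatewise bounds [u] on the distance over that window are enough.
    Taking the supremum of each coefficient over time gives a bound that does
    not depend on [m], which is what yields a uniform contraction factor. *)
Lemma model_rhs_dist_le (x y : 'I_N -> int -> R) (u : 'I_N -> R)
    (m k : nat) (i : 'I_N) :
  (tau <= k)%N -> (forall j l, tauf i j l m <= k)%N ->
  (forall j l, xi i j l m <= k)%N ->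
  (forall j (s : nat), (s <= k)%N ->
    `|x j (m%:Z - s%:Z) - y j (m%:Z - s%:Z)| <= u j) ->
  `|model_rhs tau c a b tauf xi f g x m i
    - model_rhs tau c a b tauf xi f g y m i|
  <= sup_abs (c i) * u i
     + \sum_(j < N) (sup_abs (a i j) * (F j * u j)
         + \sum_(l < N) sup_abs (b i j l)
             * (mg j * (G l * u l) + mg l * (G j * u j))).
Proof.
move=> tauk tk xk xyu; rewrite /model_rhs.
have ac j s t M : `|s| <= M -> `|t| <= u j -> `|s * t| <= M * u j.
  by move=> sM tu; rewrite normrM ler_pM.
have absc n : `|c i n| <= 1.
  by rewrite ler_norml; have /andP[/ltW -> /ltW ->] := c_range i n.
rewrite big_split /=.
rewrite !opprD addrACA [X in `|X + _|]addrACA -!sumrB addrA.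
rewrite (le_trans (ler_normD _ _))// lerD//.
  rewrite (le_trans (ler_normD _ _))// lerD//.
    by rewrite -mulrBr; apply: ac (le_sup_abs _ absc) (xyu _ _ tauk).
  rewrite (le_trans (ler_norm_sum _ _ _))// ler_sum// => j _.
  rewrite -mulrBr normrM ler_pM//; first exact: le_sup_abs_bounded.
  apply: lipschitz_le (f_lipschitz j) _.
  by have := xyu j 0%N isT; rewrite subr0.
rewrite (le_trans (ler_norm_sum _ _ _))// ler_sum// => j _.
rewrite -sumrB (le_trans (ler_norm_sum _ _ _))// ler_sum// => l _.
rewrite -!mulrA -mulrBr normrM ler_pM//; first exact: le_sup_abs_bounded.
apply: dist_mul_le => //.
- by apply: lipschitz_le (g_lipschitz j) (xyu _ _ (tk _ _)).
- by apply: lipschitz_le (g_lipschitz l) (xyu _ _ (xk _ _)).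
Qed.

End Model_rhs_distance.

Unset Implicit Arguments.
Set Strict Implicit.

Theorem theorem7 (R : realType) (N tau : nat)
  (c : 'I_N -> nat -> R)
  (tauf xi : 'I_N -> 'I_N -> 'I_N -> nat -> nat)
  (a : 'I_N -> 'I_N -> nat -> R)
  (b : 'I_N -> 'I_N -> 'I_N -> nat -> R)
  (f g : 'I_N -> R -> R)
  (F G mg : 'I_N -> R)
  (N_gt0 : (0 < N)%N)
  (c_range : forall i m, -1 < c i m < 1)
  (a_bounded : forall i j, bounded_fun (a i j))
  (b_bounded : forall i j l, bounded_fun (b i j l))
  (tauf_bounded : forall i j l, has_ubound (range (tauf i j l)))
  (xi_bounded : forall i j l, has_ubound (range (xi i j l)))
  (f_lipschitz : forall j x y, `|f j x - f j y| <= F j * `|x - y|)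
  (g_lipschitz : forall j x y, `|g j x - g j y| <= G j * `|x - y|)
  (mg_gt0 : forall j, 0 < mg j)
  (g_bounded : forall j u, `|g j u| <= mg j)
  (weights : exists d : 'I_N -> R,
    (forall i, 0 < d i) /\
    (forall i,
      d i * (1 - sup_abs (c i)) >
      \sum_(j < N) (d j * F j * sup_abs (a i j)
        + \sum_(l < N) sup_abs (b i j l)
            * (mg j * d l * G l + mg l * d j * G j)))) :
  globally_exponentially_stable tau c a b tauf xi f g.
Proof.
have [d [d0 hd]] := weights.
have [_ hk] := max_delayP tau tauf_bounded xi_bounded.
rewrite /globally_exponentially_stable; set k := max_delay tau tauf xi in hk *.
have tauk : (tau <= k)%N by apply: hk; left.
have tk i j l m : (tauf i j l m <= k)%N.
  by apply: hk; right; exists i, j, l, m; left.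
have xk i j l m : (xi i j l m <= k)%N.
  by apply: hk; right; exists i, j, l, m; right.
(* What [model_rhs_dist_le] gives for the window distances [u = d]; that bound
   is linear in [u], so [u = d * V] gives [S i * V]. *)
pose S i := sup_abs (c i) * d i
  + \sum_(j < N) (sup_abs (a i j) * (F j * d j)
      + \sum_(l < N) sup_abs (b i j l)
          * (mg j * (G l * d l) + mg l * (G j * d j))).
have Sd i : S i < d i.
  have := hd i; rewrite mulrBr mulr1 ltrBrDl.
  rewrite [X in X < _ -> _](_ : _ = S i)// /S mulrC; congr (_ + _).
  apply: eq_bigr => j _; congr (_ + _); first by ring.
  by apply: eq_bigr => l _; ring.
have [q [q01 Sq]] := ex_common_ratio d0 Sd.
have [z [z01 zq]] := ex_root_lt1 k q01.
have [z0 z1] := andP z01.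
pose D := \sum_i d i; pose M := \sum_i (d i)^-1.
have dD i : d i <= D.
  by rewrite /D (bigD1 i)//= lerDl sumr_ge0// => j _; exact: ltW.
have dM i : (d i)^-1 <= M.
  by rewrite /M (bigD1 i)//= lerDl sumr_ge0// => j _; rewrite invr_ge0 ltW.
have D0 : 0 < D by apply: lt_le_trans (d0 (Ordinal N_gt0)) (dD _).
have M0 : 0 < M.
  by apply: lt_le_trans (dM (Ordinal N_gt0)); rewrite invr_gt0.
exists (D * M / z ^+ k), z; split=> //.
  by rewrite divr_gt0 ?mulr_gt0// exprn_gt0.
move=> alpha beta x y [x0 xS] [y0 yS] m.
pose w i (t : int) := `|x i t - y i t| / d i.
have wE i t V : (w i t <= V) = (`|x i t - y i t| <= V * d i).
  by rewrite /w ler_pdivrMr.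
have winit i s : (s <= k)%N -> w i (0%:Z - s%:Z) <= `|alpha - beta| * M.
  move=> sk; rewrite /w ler_pM ?invr_ge0 ?(ltW (d0 i))//.
  have := mx_entry_le_norm (alpha - beta) i (Ordinal (sk : (s < k.+1)%N)).
  by rewrite -x0 -y0 !mxE.
have wstep n V : 0 <= V ->
    (forall i s, (s <= k)%N -> w i (n%:Z - s%:Z) <= V) ->
    forall i, w i n.+1%:Z <= q * V.
  move=> V0 wV i.
  have wV' j s : (s <= k)%N ->
      `|x j (n%:Z - s%:Z) - y j (n%:Z - s%:Z)| <= d j * V.
    by move=> sk; rewrite mulrC -wE; exact: wV.
  rewrite wE xS yS mulrAC.
  apply: le_trans (ler_wpM2r V0 (Sq i)).
  have := model_rhs_dist_le c_range a_bounded b_bounded f_lipschitz g_lipschitz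
    g_bounded (u := fun j => d j * V) tauk (fun j l => tk i j l n)
    (fun j l => xk i j l n) wV'.
  move/le_trans; apply.
  rewrite /S mulrDl mulr_suml -mulrA lerD2l ler_sum// => j _.
  rewrite mulrDl mulr_suml !mulrA lerD2l ler_sum// => l _.
  by rewrite le_eqVlt; apply/orP; left; apply/eqP; ring.
have zle : q <= z ^+ k.+1 by rewrite zq.
have E0 : 0 <= `|alpha - beta| * M by rewrite mulr_ge0// ltW.
have z01' : 0 < z <= 1 by rewrite z0 ltW.
have wdecay := halanay z01' zle E0 winit wstep m.
have -> : D * M / z ^+ k * z ^+ m * `|alpha - beta|
    = `|alpha - beta| * M / z ^+ k * z ^+ m * D.
  by ring.
have K0 : 0 <= `|alpha - beta| * M / z ^+ k * z ^+ m.
  by rewrite mulr_ge0 ?divr_ge0 ?exprn_ge0// ltW.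
apply: mx_norm_le_entries => [|i s]; first by rewrite mulr_ge0// ltW.
rewrite !mxE.
apply: le_trans (ler_wpM2l K0 (dD i)).
by rewrite -wE; apply: wdecay; rewrite -ltnS.
Qed.
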